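(* Let $C$ be a nonempty, closed and convex subset of a locally compact Hadamard space $\mathscr{H}$ and let $T:C\to C$ be a nonexpansive mapping with $F(T)\neq\emptyset$. Then for every $x\in C$ the sequence $\{T^nx\}_{n\ge 0}$ is almost convergent to a fixed point of $T$.
   Context: A Hadamard space is a complete $CAT(0)$ space; $d$ denotes its metric. A mapping $T$ is nonexpansive if $d(Tx,Ty)\leq d(x,y)$ for all $x,y$ in its domain, and $F(T)=\{x : Tx=x\}$ is its set of fixed points. For a sequence $\{x_n\}_{n\geq 0}$ in a Hadamard space $\mathscr{H}$, $n\in\mathbb{N}$ ($n\ge 1$) and $k\in\mathbb{N}\cup\{0\}$, let $\sigma_n^k$ (the Karcher mean of $x_k,\ldots,x_{k+n-1}$) be the unique minimizer over $\mathscr{H}$ of the function $\mathcal{F}_n^k(y)=\frac{1}{n}\sum_{i=0}^{n-1} d^2(x_{k+i},y)$; it is known that a unique minimizer exists. The sequence $\{x_n\}$ is called almost convergent to $z\in\mathscr{H}$ if $\sigma_n^k$ converges to $z$ as $n\to\infty$ uniformly in $k\geq 0$, i.e. $\lim_{n\to\infty}\sup_{k\geq 0} d(\sigma_n^k,z)=0$. Here this is applied to $x_n=T^nx$. *)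

(* Defs.v *)
From HB Require Import structures.
From mathcomp Require Import all_boot all_order all_algebra.
From mathcomp Require Import all_classical all_reals all_analysis.
Set Implicit Arguments.
Unset Strict Implicit.
Unset Printing Implicit Defensive.
Import Order.TTheory GRing.Theory Num.Theory.
Import numFieldNormedType.Exports.
Local Open Scope classical_set_scope.
Local Open Scope ring_scope.

(* Distances in the Euclidean plane: the library norm on ['rV[R]_2] is the
   sup norm. *)
Definition edist (R : realType) (u v : 'rV[R]_2) : R :=
  Num.sqrt (\sum_i (u 0 i - v 0 i) ^+ 2).

Definition geodesic (R : realType) (M : metricType R) (x y : M) (c : R -> M) :=
  [/\ c 0 = x, c (mdist x y) = y &
    {in `[0, mdist x y]%R &, forall s t, mdist (c s) (c t) = `|s - t|}].

(* [p'] is the point of the Euclidean segment [x', y'] corresponding to the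
   point [p] of the geodesic segment [c] issued from [x] and ending at [y]. *)
Definition comparison_point (R : realType) (M : metricType R)
    (x y : M) (c : R -> M) (x' y' : 'rV[R]_2) (p : M) (p' : 'rV[R]_2) :=
  [/\ exists2 s : R, s \in `[0, mdist x y]%R & p = c s,
      exists2 t : R, t \in `[0, 1]%R & p' = (1 - t) *: x' + t *: y' &
      edist x' p' = mdist x p].

(* A geodesic triangle has vertices [v i] and sides [c i] from [v i] to
   [v (i + 1)], where [i + 1] is taken modulo 3; the points [v' i] are the
   vertices of a comparison triangle. *)
Definition cat0_space (R : realType) (M : metricType R) :=
  (forall x y : M, exists c, geodesic x y c) /\
  forall (v : 'I_3 -> M) (c : 'I_3 -> R -> M) (v' : 'I_3 -> 'rV[R]_2),
    (forall i, geodesic (v i) (v (i + 1)) (c i)) ->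
    (forall i j, edist (v' i) (v' j) = mdist (v i) (v j)) ->
    forall i j p q p' q',
      comparison_point (v i) (v (i + 1)) (c i) (v' i) (v' (i + 1)) p p' ->
      comparison_point (v j) (v (j + 1)) (c j) (v' j) (v' (j + 1)) q q' ->
      mdist p q <= edist p' q'.

HB.mixin Record Metric_isCAT0 (R : realType) M & Metric R M := {
  cat0P : cat0_space M
}.

(* The library's [Complete] includes [Pointed], so these spaces are nonempty. *)
#[short(type="hadamardType")]
HB.structure Definition Hadamard (R : realType) :=
  {M of CompletePseudoMetric R M & Metric R M & Metric_isCAT0 R M}.

Definition geodesically_convex (R : realType) (M : metricType R) (C : set M) :=
  forall x y c, C x -> C y -> geodesic x y c ->
    forall t, t \in `[0, mdist x y]%R -> C (c t).

Definition nonexpansive_on (R : realType) (M : metricType R) (C : set M)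
    (T : M -> M) :=
  forall x y, C x -> C y -> mdist (T x) (T y) <= mdist x y.

Definition fixed_points (M : Type) (C : set M) (T : M -> M) : set M :=
  [set x | C x /\ T x = x].

Definition karcher_fun (R : realType) (M : metricType R) (x : nat -> M)
    (n k : nat) (y : M) : R :=
  n%:R^-1 * \sum_(i < n) mdist (x (k + i)%N) y ^+ 2.

(* In a Hadamard space and for [0 < n] the set of minimizers is a singleton;
   the default value [x k] is never used there. *)
Definition karcher_mean (R : realType) (M : metricType R) (x : nat -> M)
    (n k : nat) : M :=
  xget (x k) [set y | forall w, karcher_fun x n k y <= karcher_fun x n k w].

(* The supremum is taken in the extended reals, as it is not known in advance
   to be finite. *)
Definition almost_convergent (R : realType) (M : metricType R) (x : nat -> M)
    (z : M) :=
  (fun n => ereal_sup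
     (range (fun k => (mdist (karcher_mean x n k) z)%:E))) @ \oo --> 0%E.

(* Main.v *)
Require Import Defs.
From mathcomp Require Import all_boot all_order all_algebra.
From mathcomp Require Import all_classical all_reals all_analysis.
From mathcomp Require Import ring lra zify.
Set Implicit Arguments.
Unset Strict Implicit.
Unset Printing Implicit Defensive.
Import Order.TTheory GRing.Theory Num.Theory.
Import numFieldNormedType.Exports.
Local Open Scope classical_set_scope.
Local Open Scope ring_scope.

(** Write [x_i] for the orbit of [x], [F_n^k(w)] for the average of
[d(x_(k+i), w)^2] over [i < n], and [s_n^k] for its minimizer.

The CAT(0) condition makes [d(z, -)^2] strongly convex along geodesics
([cat0_cn]), hence also every [F_n^k]; by completeness each [F_n^k] has a
minimizer, with quadratic growth [F_n^k(s_n^k) + d(s_n^k, w)^2 <= F_n^k(w)]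
([karcher_meanP]).  So, if [F_n^k] and [F_m^l] differ by at most [e ^ 2] at the
two minimizers, adding the two growth inequalities gives
[d(s_n^k, s_m^l) <= e].  Everything reduces to the following claim: for [n]
and [m] large, [F_n^k] and [F_m^l] are close, uniformly in [k] and [l] and in
[w] on a ball containing all the means ([karcher_fun_uniform]).

This is where local compactness enters.  The orbit is bounded because [T] has a
fixed point, and closed balls are compact by the Hopf-Rinow theorem
([cball_compact]), so the orbit has finite [e]-nets.  As [T] is nonexpansive,
[d(x_m, x_j) <= e] persists along the orbit, and a finite net therefore yields
a relatively dense set of [e]-almost-periods, valid from some rank on
([compact_almost_period]).  For a bounded real sequence with this property, the
average over a long window nearly does not depend on where the window starts,
and cutting a window of length [m * n] into blocks, of length [n] or of length
[m], shows that it nearly does not depend on its length either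
([almost_periodic_mean]).  Apply this to the sequences [d(x_i, w)^2].

Hence the means [s_n^k] are Cauchy uniformly in [k] and converge to some [z].
They lie in [C], since projecting onto [C] decreases the distances to the
orbit, so [z] does.  Finally [F_n^(k+1)(T w) <= F_n^k(w)] for [w] in [C], so
[T s_n^k] almost minimizes [F_n^(k+1)]: it is close to [s_n^(k+1)], and in the
limit [T z = z]. *)

(** * The CN inequality in CAT(0) spaces *)

(* This name also denotes the extended distance of pseudometric spaces. *)
Local Notation edist := Defs.edist.

Section plane.
Context {R : realType}.

Definition plane_point (a b : R) : 'rV[R]_2 := \row_i (if i == 0 then a else b).

Lemma edistE (u v : 'rV[R]_2) :
  edist u v = Num.sqrt ((u 0 0 - v 0 0) ^+ 2 + (u 0 1 - v 0 1) ^+ 2).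
Proof.
rewrite /edist big_ord_recl big_ord1.
by congr (Num.sqrt (_ + (_ - _) ^+ 2)); congr (_ _ _); apply: val_inj.
Qed.

Lemma edistC (u v : 'rV[R]_2) : edist u v = edist v u.
Proof. by rewrite !edistE -[u 0 0 - _]opprB -[u 0 1 - _]opprB !sqrrN. Qed.

Lemma edistxx (u : 'rV[R]_2) : edist u u = 0.
Proof. by rewrite edistE !subrr expr0n addr0 sqrtr0. Qed.

Lemma edist_sqr (u v : 'rV[R]_2) :
  edist u v ^+ 2 = (u 0 0 - v 0 0) ^+ 2 + (u 0 1 - v 0 1) ^+ 2.
Proof. by rewrite edistE sqr_sqrtr// addr_ge0 ?sqr_ge0. Qed.

Lemma edist_ge0 (u v : 'rV[R]_2) : 0 <= edist u v.
Proof. exact: sqrtr_ge0. Qed.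

Lemma edist_segment (u v : 'rV[R]_2) (t : R) : 0 <= t ->
  edist u ((1 - t) *: u + t *: v) = t * edist u v.
Proof.
move=> t0; apply/eqP; rewrite -(@eqrXn2 _ 2)// ?edist_ge0 ?mulr_ge0 ?edist_ge0//.
by apply/eqP; rewrite exprMn !edist_sqr !mxE; ring.
Qed.

(** Stewart's theorem. *)
Lemma edist_stewart (u v w : 'rV[R]_2) (t : R) :
  edist w ((1 - t) *: u + t *: v) ^+ 2 =
  (1 - t) * edist w u ^+ 2 + t * edist w v ^+ 2 - t * (1 - t) * edist u v ^+ 2.
Proof. by rewrite !edist_sqr !mxE; ring. Qed.

(** The first vertex is the origin, the second lies on the first axis and the
third is given by the law of cosines. *)
Lemma comparison_triangle (a b c : R) : 0 <= a -> 0 <= b -> 0 <= c ->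
  a <= b + c -> b <= a + c -> c <= a + b ->
  exists A B C, [/\ edist A B = a, edist A C = b & edist B C = c].
Proof.
move=> a0 b0 c0 abc bac cab.
have sq (x y z : R) : 0 <= z -> x ^+ 2 + y ^+ 2 = z ^+ 2 ->
  Num.sqrt (x ^+ 2 + y ^+ 2) = z by move=> z0 ->; rewrite sqrtr_sqr ger0_norm.
have [a_eq0|a_neq0] := eqVneq a 0.
  have bc : b = c by lra.
  exists (plane_point 0 0), (plane_point 0 0), (plane_point b 0).
  by rewrite !edistE !mxE /= a_eq0 -bc; split; apply: sq => //; ring.
have a_gt0 : 0 < a by rewrite lt_neqAle eq_sym a_neq0.
pose u := (a ^+ 2 + b ^+ 2 - c ^+ 2) / (2 * a).
have au : a * u * 2 = a ^+ 2 + b ^+ 2 - c ^+ 2 by rewrite /u; field.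
(* [a * (b - u)] and [a * (b + u)] are half of [c^2 - (a - b)^2] and
   [(a + b)^2 - c^2]. *)
have ub : 0 <= b ^+ 2 - u ^+ 2.
  rewrite subr_sqr mulr_ge0//.
    by rewrite -(pmulr_rge0 _ a_gt0); nra.
  by rewrite -(pmulr_rge0 _ a_gt0); nra.
pose w := Num.sqrt (b ^+ 2 - u ^+ 2).
have ww : w ^+ 2 = b ^+ 2 - u ^+ 2 by rewrite /w sqr_sqrtr.
exists (plane_point 0 0), (plane_point a 0), (plane_point u w).
rewrite !edistE !mxE /=; split; apply: sq => //; first by ring.
  by rewrite !sub0r !sqrrN ww; ring.
by rewrite sub0r sqrrN ww sqrrB -mulr_natr au; ring.
Qed.
End plane.

(** The comparison of a vertex of a triangle with a point of the opposite side:
the right-hand side is the squared Euclidean distance in a comparison triangle,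
by Stewart's theorem. *)
Lemma cat0_cn (R : realType) (M : metricType R) (x y z : M) c t :
  cat0_space M -> geodesic x y c -> 0 <= t <= 1 ->
  mdist z (c (t * mdist x y)) ^+ 2 <=
  (1 - t) * mdist z x ^+ 2 + t * mdist z y ^+ 2 - t * (1 - t) * mdist x y ^+ 2.
Proof.
move=> [geo cat0] gc /andP[t0 t1].
have [c1 gc1] := geo y z; have [c2 gc2] := geo z x.
have tr := @metric_triangle _ M; have sy := @metric_sym _ M.
have dge := @mdist_ge0 R M.
have [||||||A [B [C [AB AC BC]]]] :=
  @comparison_triangle _ (mdist x y) (mdist x z) (mdist y z).
all: rewrite ?dge//.
  by rewrite [mdist y z]sy tr.
  by rewrite [mdist x y]sy tr.
have BA : edist B A = mdist y x by rewrite edistC AB sy.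
have CA : edist C A = mdist z x by rewrite edistC AC sy.
have CB : edist C B = mdist z y by rewrite edistC BC sy.
pose v (i : 'I_3) := nth x [:: x; y; z] i.
pose v' (i : 'I_3) := nth A [:: A; B; C] i.
pose cc (i : 'I_3) := nth c [:: c; c1; c2] i.
have t01 : t \in `[0, 1]%R by rewrite in_itv/= t0 t1.
have gcc i : geodesic (v i) (v (i + 1)) (cc i).
  by case: i => [[|[|[|//]]] ?].
have vv i j : edist (v' i) (v' j) = mdist (v i) (v j).
  by case: i => [[|[|[|//]]] ?]; case: j => [[|[|[|//]]] ?];
    rewrite /v /v' /= ?edistxx ?mdistxx.
have tin : t * mdist x y \in `[0, mdist x y]%R.
  by rewrite in_itv/= mulr_ge0// ler_piMl.
have zz : comparison_point z x c2 C A z C.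
  split; last by rewrite edistxx mdistxx.
    exists 0; first by rewrite in_itv/= lexx dge.
    by case: gc2.
  exists 0; first by rewrite in_itv/= lexx ler01.
  by rewrite subr0 scale1r scale0r addr0.
have qq : comparison_point x y c A B
    (c (t * mdist x y)) ((1 - t) *: A + t *: B).
  split.
  - by exists (t * mdist x y).
  - by exists t.
  - rewrite edist_segment// AB; case: gc => c0 _ iso.
    rewrite -{2}c0 iso//; last by rewrite in_itv/= lexx dge.
    by rewrite sub0r normrN ger0_norm// mulr_ge0.
have := @cat0 v cc v' gcc vv
  (Ordinal (isT : 2 < 3)%N) (Ordinal (isT : 0 < 3)%N) z
  (c (t * mdist x y)) C ((1 - t) *: A + t *: B) zz qq.
move=> le; rewrite -(ler_sqr) ?nnegrE ?edist_ge0// in le.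
apply: le_trans le _.
by rewrite edist_stewart AB CA CB.
Qed.

(** * Closed balls are compact (Hopf-Rinow) *)

Section metric.
Context {R : realType} {M : metricType R}.
Implicit Types x y z : M.

Lemma mdist_distl z x y : `|mdist z x - mdist z y| <= mdist x y.
Proof.
have := metric_triangle z x y; have := metric_triangle z y x.
rewrite [mdist y x]metric_sym ler_norml => ? ?; apply/andP; split; lra.
Qed.

Lemma mdist_continuous z : continuous (fun y => mdist z y : R).
Proof.
move=> x; apply/cvgrPdist_le => /= e e0.
near=> y; apply: le_trans (mdist_distl _ _ _) _; apply/ltW.
by near: y; have := nbhsx_ballx x _ e0; rewrite ballEmdist.
Unshelve. all: by end_near. Qed.

Definition cball x (r : R) : set M := [set y | mdist x y <= r].

Lemma cball_closed x r : closed (cball x r).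
Proof.
by apply: (closed_comp _ (@closed_le R r)) => y _; exact: mdist_continuous.
Qed.

Lemma cball_limit x r (F : set_system M) l :
  ProperFilter F -> F (cball x r) -> F --> l -> cball x r l.
Proof.
move=> FP Fr Fl; have h := @closed_cvg M M F FP id _ (@cball_closed x r) Fr l.
exact: h.
Qed.

(** Pull the points of a neighborhood of a compact set [K] back to [K]: the image
of the ultrafilter clusters at some [q], and the ultrafilter itself must then
concentrate near [q].  This replaces the extraction of finite nets. *)
Lemma ultra_near_compact (F : set_system M) (K : set M) (e e' : R) :
  UltraFilter F -> compact K -> e < e' ->
  (\forall y \near F, exists2 q, K q & mdist q y <= e) ->
  exists2 q, K q & \forall y \near F, mdist q y <= e'.
Proof.
move=> FU Kc ee' FK.
have FP : ProperFilter F by apply: ultra_proper.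
have /choice[pi piP] : forall y, exists q,
    (exists2 q, K q & mdist q y <= e) -> K q /\ mdist q y <= e.
  move=> y; have [[q Kq qy]|n] := pselect (exists2 q, K q & mdist q y <= e).
    by exists q.
  by exists y => /n.
have piK : (pi @ F) K by apply: filterS FK => y /piP[].
have [q [Kq qcl]] := Kc _ (fmap_proper_filter pi FP) piK.
exists q => //.
have [//|nF] := in_ultra_setVsetC [set y | mdist q y <= e'] FU.
exfalso.
have e0 : 0 < e' - e by rewrite subr_gt0.
have G : (pi @ F) (pi @` ([set y | exists2 q, K q & mdist q y <= e] `&`
    ~` [set y | mdist q y <= e'])).
  by apply: filterS (filterI FK nF) => y yP; exists y.
have [_ [[y [/piP[_ piy] /= ny] <-]]] := qcl _ _ G (nbhsx_ballx q _ e0).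
rewrite ballEmdist/= => qpi; apply: ny.
have := metric_triangle q (pi y) y; lra.
Qed.
End metric.

Section hopf_rinow.
Context {R : realType} {H : hadamardType R}.
Implicit Types p q : H.

Lemma geodesic_retract p y (r e : R) : 0 <= r -> 0 <= e -> mdist p y <= r + e ->
  exists2 q, cball p r q & mdist q y <= e.
Proof.
move=> r0 e0 pye.
have [pyr|rpy] := leP (mdist p y) r; first by exists y; rewrite ?mdistxx.
have [geo _] := @cat0P R H.
have [c [cp cy ciso]] := geo p y.
have d0 := mdist_ge0 p y.
have r_in : r \in `[0, mdist p y]%R by rewrite in_itv/= r0 ltW.
exists (c r).
  rewrite /cball/= -{1}cp ciso//; last by rewrite in_itv/= lexx.
  by rewrite sub0r normrN ger0_norm.
rewrite -{1}cy ciso//; last by rewrite in_itv/= lexx d0.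
by rewrite ler_norml; apply/andP; split; lra.
Qed.

(** An ultrafilter on the ball of radius [r] lives within [e / 3] of the compact
ball of radius [r - e / 3], for every [e], so that it is Cauchy. *)
Lemma cball_compact_lim p (r : R) : 0 < r ->
  (forall s, 0 <= s < r -> compact (cball p s)) -> compact (cball p r).
Proof.
move=> r0 cs; rewrite compact_ultra => F FU Fr.
have FP : ProperFilter F by apply: ultra_proper.
suff /cauchy_cvg cF : cauchy F.
  by exists (lim F); split => //; exact: cball_limit FP Fr cF.
apply/cauchyP => e e0.
(* The maximum keeps the smaller radius nonnegative. *)
pose s := Num.max 0 (r - e / 3).
have s0 : 0 <= s by rewrite /s le_max lexx.
have sr : s < r by rewrite /s gt_max r0; lra.
have rs : r <= s + e / 3 by rewrite -lerBlDr /s le_max lexx orbT.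
have csc : compact (cball p s) by apply: cs; rewrite s0 sr.
have [||q _ Fq] := @ultra_near_compact _ _ F (cball p s) (e / 3) (e / 2) FU csc.
- lra.
- apply: filterS Fr => y yr; apply: geodesic_retract => //; first lra.
  exact: le_trans yr rs.
- exists q; apply: filterS Fq => y; rewrite ballEmdist/= => qy; lra.
Qed.

(** By local compactness and compactness, one radius [e] makes the balls around
all points of the given ball compact; an ultrafilter on the ball of radius
[r + e / 2] concentrates on one of them. *)
Lemma cball_compact_extend p (r : R) : locally_compact [set: H] -> 0 <= r ->
  compact (cball p r) -> exists2 e, 0 < e & compact (cball p (r + e)).
Proof.
move=> lc r0 cr.
have [e e0 eP] : exists2 e : R, 0 < e &
    forall q, cball p r q -> compact (cball q e).
  move/compact_near_coveringP : (cr) =>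
    /(_ R 0^'+ (fun e q => compact (cball q e))).
  have step (x : H) : cball p r x ->
      \forall x' \near x & i \near 0^'+, compact (cball x' i).
    move=> _; have [U] := lc x I; rewrite withinET => xU [Uc Ucl].
    have [d d0 dU] : exists2 d : R, 0 < d & ball x d `<=` U.
      by move/nbhs_ballP: xU => -[d d0 dU]; exists d.
    exists (ball x (d / 2), [set e : R | e < d / 2]).
      split => /=; first by apply: nbhsx_ballx; lra.
      by apply: nbhs_right_lt; lra.
    move=> [q e] /= []; rewrite ballEmdist /= => xq ed.
    apply: subclosed_compact (@cball_closed _ _ q e) Uc _ => y qy.
    apply: dU; rewrite ballEmdist /=; have := metric_triangle x q y.
    move: qy; rewrite /cball /=; lra.
  move=> /(_ _ step) nr.
  have : \forall e \near (0:R)^'+, 0 < e /\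
      (forall q, cball p r q -> compact (cball q e)).
    near=> e; split; first by near: e; exact: nbhs_right_gt.
    by near: e; exact: nr.
  by move=> /filter_ex[e [e0 eP]]; exists e.
exists (e / 2); first lra.
rewrite compact_ultra => F FU Fr.
have FP : ProperFilter F by apply: ultra_proper.
have [||q rq Fq] := @ultra_near_compact _ _ F (cball p r) (e / 2) e FU cr.
- lra.
- apply: filterS Fr => y yr; apply: geodesic_retract => //; lra.
have := eP q rq; rewrite compact_ultra => /(_ F FU Fq)[z [_ Fz]].
by exists z; split => //; exact: cball_limit FP Fr Fz.
Unshelve. all: by end_near. Qed.

(** Hopf-Rinow: the radii of the compact balls form an interval issued from [0];
its supremum, if finite, belongs to it and can be exceeded. *)
Lemma cball_compact p (r : R) : locally_compact [set: H] -> compact (cball p r).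
Proof.
move=> lc.
have sub s s' : s <= s' -> compact (cball p s') -> compact (cball p s).
  move=> ss' cs'; apply: subclosed_compact (@cball_closed _ _ p s) cs' _.
  by move=> y ys; exact: le_trans ys ss'.
have c0 : compact (cball p 0).
  suff -> : cball p 0 = [set p] by exact: compact_set1.
  apply/seteqP; split => y /=; last by rewrite /cball /= => ->; rewrite mdistxx.
  rewrite /cball /= => yp; apply/esym/mdist_positivity/eqP.
  by rewrite eq_le yp mdist_ge0.
apply: contrapT => ncr.
pose S := [set s : R | 0 <= s /\ compact (cball p s)].
have S0 : S 0 by split.
have ubr : ubound S r.
  move=> s [s0 cs]; rewrite leNgt; apply/negP => rs; apply: ncr.
  exact: sub (ltW rs) cs.
have m0 := ub_le_sup (ex_intro _ r ubr) S0.
have cm : compact (cball p (sup S)).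
  have [->//|m_neq0] := eqVneq (sup S) 0.
  apply: cball_compact_lim; first by rewrite lt_neqAle eq_sym m_neq0.
  move=> s /andP[s0 sm]; have [s' [s'0 cs'] ss'] := sup_gt (ex_intro _ 0 S0) sm.
  exact: sub (ltW ss') cs'.
have [e e0 ce] := cball_compact_extend lc m0 cm.
have Sme : S (sup S + e) by split => //; lra.
have := ub_le_sup (ex_intro _ r ubr) Sme.
lra.
Qed.
End hopf_rinow.

(** * Minimizers of strongly convex functions, Karcher means *)

Section strongly_convex.
Context {R : realType} {H : hadamardType R}.
Implicit Types (F : H -> R) (C : set H).

(** The modulus is normalized so that squared distances satisfy it. *)
Definition strongly_convex F := forall x y c t,
  geodesic x y c -> 0 <= t <= 1 ->
  F (c (t * mdist x y)) <=
    (1 - t) * F x + t * F y - t * (1 - t) * mdist x y ^+ 2.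

(** Compare [F m] with [F] at the point of parameter [t] of the geodesic from [m]
to [w]: this gives [(1 - t) * d(m, w)^2 <= F w - F m], and [t] can be taken
arbitrarily small. *)
Lemma strongly_convex_growth F C m : strongly_convex F ->
  geodesically_convex C -> C m -> (forall w, C w -> F m <= F w) ->
  forall w, C w -> F m + mdist m w ^+ 2 <= F w.
Proof.
move=> Fsc Ccvx Cm Fm w Cw.
have [geo _] := @cat0P R H.
have [c gc] := geo m w.
set D := mdist m w ^+ 2; have D0 : 0 <= D by exact: sqr_ge0.
rewrite leNgt; apply/negP => FwD.
have Fmw := Fm w Cw.
have Dgt0 : 0 < D by lra.
set a := F w - F m.
(* This [t] is chosen so that [(1 - t) * D = (D + a) / 2 > a]. *)
pose t := (D - a) / (2 * D).
have tD : t * (2 * D) = D - a by rewrite /t divfK//; lra.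
have t0 : 0 < t by apply: divr_gt0; rewrite /a; lra.
have t1 : t <= 1 by rewrite /t ler_pdivrMr /a; lra.
have t01 : 0 <= t <= 1 by rewrite t1 ltW.
have Ct : C (c (t * mdist m w)).
  apply: Ccvx Cm Cw gc _ _.
  rewrite in_itv/=; apply/andP; split; first by rewrite mulr_ge0 ?mdist_ge0// ltW.
  by rewrite ler_piMl ?mdist_ge0.
have := le_trans (Fm _ Ct) (Fsc _ _ _ _ gc t01).
rewrite -/D; suff : t * (F m + D - t * D) > t * F w by lra.
by rewrite ltr_pM2l//; rewrite /a in tD; lra.
Qed.

(** The sublevel sets of [F] near its infimum have small diameter, by strong
convexity at midpoints; completeness provides the limit. *)
Lemma strongly_convex_argmin F C : strongly_convex F -> continuous F ->
  (forall y, 0 <= F y) -> closed C -> C !=set0 -> geodesically_convex C ->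
  exists2 m, C m & forall w, C w -> F m + mdist m w ^+ 2 <= F w.
Proof.
move=> Fsc Fc F0 Ccl [y0 Cy0] Ccvx.
suff [m Cm Fm] : exists2 m, C m & forall w, C w -> F m <= F w.
  by exists m => //; exact: strongly_convex_growth.
pose I := inf (F @` C).
have hi : has_inf (F @` C).
  by split; [exists (F y0), y0|exists 0 => _ [y _ <-]].
have Ile y : C y -> I <= F y.
  by move=> Cy; apply: ge_inf; [case: hi|exists y].
pose S e := [set y | C y /\ F y < I + e].
have Sn e : 0 < e -> S e !=set0.
  move=> e0; have [_ [y Cy <-] ye] := inf_adherent e0 hi.
  by exists y.
pose G := filter_from [set e : R | 0 < e] S.
have GP : ProperFilter G.
  apply: filter_from_proper => //; apply: filter_from_filter.
    by exists 1 => /=.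
  move=> e e' /= e0 e'0; exists (Num.min e e'); first by rewrite /= lt_min e0.
  by move=> y [Cy]; rewrite -ltrBlDl lt_min => /andP[? ?];
    split; split => //; lra.
have GC : G C by exists 1 => //= y [].
have /cauchy_cvg cG : cauchy G.
  apply/cauchyP => e e0.
  have e8 : 0 < e ^+ 2 / 8 by rewrite divr_gt0 ?exprn_gt0.
  have [x [Cx Fx]] := Sn _ e8.
  exists x; exists (e ^+ 2 / 8) => //= y [Cy Fy]; rewrite ballEmdist/=.
  have [geo _] := @cat0P R H.
  have [c gc] := geo x y.
  have h01 : 0 <= (2^-1 : R) <= 1 by lra.
  have Cm : C (c (2^-1 * mdist x y)).
    apply: Ccvx Cx Cy gc _ _.
    by rewrite in_itv/=; have := mdist_ge0 x y; lra.
  have := le_trans (Ile _ Cm) (Fsc _ _ _ _ gc h01).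
  rewrite ltNge; move=> Ilt; apply/negP => exy.
  have : e ^+ 2 <= mdist x y ^+ 2 by rewrite ler_sqr ?nnegrE ?mdist_ge0// ltW.
  lra.
exists (lim G).
  exact: (@closed_cvg H H G GP id C Ccl GC (lim G) cG).
move=> w Cw; apply: le_trans (Ile _ Cw).
apply/ler_addgt0Pr => e e0.
have FG : F @ G --> F (lim G)
  by apply: (@cvg_comp _ _ _ id F _ _ _ cG); exact: Fc.
apply: (@closed_cvg H R G GP F _ (@closed_le R (I + e)) _ _ FG).
by exists e => //= y [_ /ltW].
Qed.

Lemma dist_sqr_strongly_convex (z : H) : strongly_convex (fun y => mdist z y ^+ 2).
Proof. by move=> x y c t gc t01; apply: cat0_cn => //; exact: cat0P. Qed.

Lemma dist_sqr_continuous (z : H) : continuous (fun y => mdist z y ^+ 2 : R).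
Proof.
move=> y; rewrite /continuous_at; under eq_fun do rewrite expr2.
by rewrite expr2; apply: cvgM; exact: mdist_continuous.
Qed.

(** Quadratic growth of [d(w, -)^2] at its minimizer [p] on [C] even gives
[d(u, p)^2 + d(w, p)^2 <= d(u, w)^2]. *)
Lemma projection C (w : H) : closed C -> C !=set0 -> geodesically_convex C ->
  exists2 p, C p & forall u, C u -> mdist u p <= mdist u w.
Proof.
move=> Ccl C0 Ccvx.
have [|p Cp pP] := @strongly_convex_argmin (fun y => mdist w y ^+ 2) C
  (@dist_sqr_strongly_convex w) (@dist_sqr_continuous w) _ Ccl C0 Ccvx.
  by move=> y; exact: sqr_ge0.
exists p => // u Cu.
rewrite -ler_sqr ?nnegrE ?mdist_ge0// [mdist u p]metric_sym [mdist u w]metric_sym.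
by apply: le_trans (pP _ Cu); rewrite lerDr sqr_ge0.
Qed.

End strongly_convex.

Section karcher.
Context {R : realType} {H : hadamardType R}.
Variables (x : nat -> H) (n : nat).
Hypothesis n_gt0 : (0 < n)%N.
Local Notation KF := (karcher_fun x n).
Local Notation KM := (karcher_mean x n).

Let nR0 : 0 < n%:R^-1 :> R. Proof. by rewrite invr_gt0 ltr0n. Qed.

Lemma karcher_fun_cst (a : R) : n%:R^-1 * (\sum_(i < n) a) = a.
Proof.
rewrite sumr_const card_ord -[a *+ n]mulr_natl.
by rewrite mulrA mulVf ?mul1r// pnatr_eq0 -lt0n.
Qed.

Lemma karcher_fun_ge0 k y : 0 <= KF k y.
Proof. by rewrite mulr_ge0 ?(ltW nR0)// sumr_ge0// => i _; exact: sqr_ge0. Qed.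

Lemma karcher_fun_continuous k : continuous (KF k).
Proof.
move=> y; apply: cvgM; first exact: cvg_cst.
by apply: cvg_big => [|i _]; [exact: add_continuous|exact: dist_sqr_continuous].
Qed.

Lemma karcher_fun_strongly_convex k : strongly_convex (KF k).
Proof.
move=> y z c t gc t01.
rewrite -(karcher_fun_cst (t * (1 - t) * _)) /karcher_fun.
rewrite !mulrA ![_ * n%:R^-1]mulrC -!mulrA -mulrDr -mulrBr ler_pM2l//.
rewrite !mulr_sumr -big_split/= -sumrB; apply: ler_sum => i _.
by rewrite mulrA; exact: dist_sqr_strongly_convex.
Qed.

(** The mean is by definition some minimizer; the growth inequality identifies it
with the one obtained from strong convexity. *)
Lemma karcher_meanP k w : KF k (KM k) + mdist (KM k) w ^+ 2 <= KF k w.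
Proof.
have [||||||m _ mP] := @strongly_convex_argmin R H (KF k) setT.
- exact: karcher_fun_strongly_convex.
- exact: karcher_fun_continuous.
- exact: karcher_fun_ge0.
- exact: closedT.
- by exists point.
- by [].
have mmin : [set y | forall w, KF k y <= KF k w] m.
  by move=> u /=; apply: le_trans (mP u I); rewrite lerDl sqr_ge0.
have Kmin := xgetPex (x k) (ex_intro _ m mmin).
suff -> : KM k = m by exact: mP.
apply/esym/mdist_positivity/eqP; rewrite -sqrf_eq0 eq_le sqr_ge0 andbT.
have := mP (KM k) I; have := Kmin m; rewrite -/(karcher_mean x n k); lra.
Qed.

(** The projection of the mean to [C] is closer to all points of the sequence, so
it is a minimizer as well. *)
Lemma karcher_mean_in (C : set H) k :
  closed C -> C !=set0 -> geodesically_convex C ->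
  (forall i, C (x i)) -> C (KM k).
Proof.
move=> Ccl C0 Ccvx Cx.
have [p Cp pP] := projection (KM k) Ccl C0 Ccvx.
suff <- : p = KM k by [].
apply/esym/mdist_positivity/eqP; rewrite -sqrf_eq0 eq_le sqr_ge0 andbT.
have := karcher_meanP k p.
suff : KF k p <= KF k (KM k) by lra.
rewrite ler_pM2l//; apply: ler_sum => i _.
by rewrite ler_sqr ?nnegrE ?mdist_ge0// pP.
Qed.

Lemma karcher_mean_bounded p (D : R) k : (forall i, mdist (x i) p <= D) ->
  mdist (KM k) p <= D.
Proof.
move=> xD; have D0 : 0 <= D by apply: le_trans (xD 0%N); exact: mdist_ge0.
rewrite -ler_sqr ?nnegrE ?mdist_ge0//.
have := karcher_meanP k p; have := karcher_fun_ge0 k (KM k).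
suff : KF k p <= D ^+ 2 by lra.
rewrite -(karcher_fun_cst (D ^+ 2)) ler_pM2l//; apply: ler_sum => i _.
by rewrite ler_sqr ?nnegrE ?mdist_ge0.
Qed.
End karcher.

(** * Uniform averages of almost periodic sequences *)

Section averages.
Context {R : realType}.
Implicit Types (a : nat -> R).

Definition window_avg a (n k : nat) : R := n%:R^-1 * \sum_(i < n) a (k + i)%N.

Lemma window_avg_mul a n k : (0 < n)%N ->
  n%:R * window_avg a n k = \sum_(i < n) a (k + i)%N.
Proof. by move=> n0; rewrite /window_avg mulrA divff ?mul1r// pnatr_eq0 -lt0n. Qed.

Lemma window_sum_shift a (B : R) n k s : (forall i, 0 <= a i <= B) ->
  `|\sum_(i < n) a (k + s + i)%N - \sum_(i < n) a (k + i)%N| <= s%:R * B.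
Proof.
move=> aB; elim: s => [|s IHs]; first by rewrite addn0 subrr normr0 mul0r.
have step : \sum_(i < n) a (k + s.+1 + i)%N - \sum_(i < n) a (k + s + i)%N =
    a (k + s + n)%N - a (k + s)%N.
  have : \sum_(i < n.+1) a (k + s + i)%N = \sum_(i < n.+1) a (k + s + i)%N by [].
  rewrite {1}big_ord_recr big_ord_recl /= addn0 => eS.
  have -> : \sum_(i < n) a (k + s.+1 + i)%N = \sum_(i < n) a (k + s + bump 0 i)%N.
    by apply: eq_bigr => i _; congr a; rewrite /bump/=; lia.
  lra.
have /andP[? ?] := aB (k + s + n)%N; have /andP[? ?] := aB (k + s)%N.
move: IHs; rewrite -natr1 mulrDl mul1r !ler_norml => /andP[? ?].
apply/andP; split; lra.
Qed.

(** Every window can be moved, by at most [2 * L] steps, to a window issued from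
[tau + L] with [tau] an almost-period, which is then compared term by term with
the window issued from [L].  The hypothesis on [n] makes the boundary terms
negligible. *)
Lemma window_avg_shift_invariant a (B eta : R) L n k l : (0 < n)%N ->
  (forall i, 0 <= a i <= B) ->
  (forall k, exists2 tau, (k <= tau <= k + L)%N &
     forall i, (L <= i)%N -> `|a (tau + i)%N - a i| <= eta) ->
  4 * L%:R * B <= n%:R * eta ->
  `|window_avg a n k - window_avg a n l| <= 3 * eta.
Proof.
move=> n0 aB aper nB.
have nR0 : 0 < n%:R :> R by rewrite ltr0n.
have B0 : 0 <= B by have /andP[? ?] := aB 0%N; lra.
have toL j : `|\sum_(i < n) a (j + i)%N - \sum_(i < n) a (L + i)%N| <=
    n%:R * eta + 2 * L%:R * B.
  have [tau /andP[jtau tauj] tauP] := aper j.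
  have := window_sum_shift n j (tau + L - j) aB.
  have -> : (j + (tau + L - j) = tau + L)%N by lia.
  have sB : (tau + L - j)%:R * B <= 2 * L%:R * B.
    by rewrite ler_wpM2r// -natrM ler_nat; lia.
  have : `|\sum_(i < n) a (tau + L + i)%N - \sum_(i < n) a (L + i)%N| <=
      n%:R * eta.
    rewrite -sumrB; apply: le_trans (ler_norm_sum _ _ _) _.
    rewrite mulr_natl -[n in _ *+ n]card_ord -sumr_const.
    by apply: ler_sum => i _; rewrite -addnA tauP// leq_addr.
  rewrite !ler_norml => /andP[? ?] /andP[? ?]; apply/andP; split; lra.
rewrite -(ler_pM2l nR0) -[n%:R in X in X <= _](ger0_norm (ltW nR0)) -normrM mulrBr.
rewrite !window_avg_mul//.
have := toL k; have := toL l.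
rewrite !ler_norml => /andP[? ?] /andP[? ?]; apply/andP; split; lra.
Qed.

(** A window of length [m * n] splits into [m] windows of length [n]. *)
Lemma window_avg_blocks a (d : R) n m : (0 < n)%N -> (0 < m)%N ->
  (forall k l, `|window_avg a n k - window_avg a n l| <= d) ->
  `|window_avg a (m * n) 0 - window_avg a n 0| <= d.
Proof.
move=> n0 m0 nd.
have blocks : \sum_(i < m * n) a (0 + i)%N =
    \sum_(j < m) n%:R * window_avg a n (j * n).
  elim: (m) => [|p IHp]; first by rewrite mul0n !big_ord0.
  rewrite mulSnr big_split_ord/= IHp big_ord_recr/=; congr (_ + _).
  by rewrite window_avg_mul.
have mR0 : 0 < m%:R :> R by rewrite ltr0n.
have nR0 : 0 < n%:R :> R by rewrite ltr0n.
have {}blocks : m%:R * window_avg a (m * n) 0 =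
    \sum_(j < m) window_avg a n (j * n).
  apply: (mulfI (lt0r_neq0 nR0)); rewrite mulrA [n%:R * _]mulrC -natrM.
  by rewrite window_avg_mul ?muln_gt0 ?m0// blocks mulr_sumr.
rewrite -(ler_pM2l mR0) -[m%:R in X in X <= _](ger0_norm (ltW mR0)) -normrM.
have const (c : R) : m%:R * c = \sum_(j < m) c.
  by rewrite sumr_const card_ord mulr_natl.
rewrite mulrBr blocks !const -sumrB.
apply: le_trans (ler_norm_sum _ _ _) _.
by apply: ler_sum.
Qed.

(** The threshold [N] depends on [a] only through [B], [L] and [eta]; this is what
makes the averages of [d(x_i, w)^2] converge uniformly in [w].  The constant
[12] comes from the path (n, k), (n, 0), (m * n, 0), (m, 0), (m, l). *)
Lemma almost_periodic_mean (B eta : R) L : 0 < eta -> exists2 N, (0 < N)%N &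
  forall a, (forall i, 0 <= a i <= B) ->
    (forall k, exists2 tau, (k <= tau <= k + L)%N &
       forall i, (L <= i)%N -> `|a (tau + i)%N - a i| <= eta) ->
  forall n m k l, (N <= n)%N -> (N <= m)%N ->
    `|window_avg a n k - window_avg a m l| <= 12 * eta.
Proof.
move=> eta0.
exists (Num.truncn (4 * L%:R * B / eta)).+1 => // a aB aper n m k l Nn Nm.
have large j : (Num.truncn (4 * L%:R * B / eta) < j)%N ->
    4 * L%:R * B <= j%:R * eta.
  move=> Nj; rewrite -ler_pdivrMr//; apply: ltW.
  by apply: lt_le_trans (truncnS_gt _) _; rewrite ler_nat.
have n0 : (0 < n)%N by lia.
have m0 : (0 < m)%N by lia.
have nP k' l' := window_avg_shift_invariant k' l' n0 aB aper (large _ Nn).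
have mP k' l' := window_avg_shift_invariant k' l' m0 aB aper (large _ Nm).
have := window_avg_blocks n0 m0 nP; have := window_avg_blocks m0 n0 mP.
rewrite [(m * n)%N]mulnC; have := nP k 0%N; have := mP l 0%N.
rewrite !ler_norml => /andP[? ?] /andP[? ?] /andP[? ?] /andP[? ?].
apply/andP; split; lra.
Qed.
End averages.

(** * Almost-periods of nonexpansive orbits *)

Section nonexpansive_sequence.
Context {R : realType} {M : metricType R}.
Variable x : nat -> M.
Hypothesis x_ne : forall i j k,
  mdist (x (i + k)) (x (j + k)) <= mdist (x i) (x j).

(** Near a point of [K] that the sequence approaches, one index suffices; near the
other points of [K] there is nothing to cover. *)
Lemma compact_net (K : set M) (e : R) :
  compact K -> (forall i, K (x i)) -> 0 < e ->
  exists L, forall m, exists2 j, (j <= L)%N & mdist (x j) (x m) <= e.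
Proof.
move=> Kc Kx e0.
move/compact_near_coveringP : Kc.
move=> /(_ _ \oo (fun L q => forall m, x m = q ->
  exists2 j, (j <= L)%N & mdist (x j) q <= e)).
have step q : K q -> \forall q' \near q & L \near \oo,
    forall m, x m = q' -> exists2 j, (j <= L)%N & mdist (x j) q' <= e.
  move=> _; have [[j qj]|nj] := pselect (exists j, ball q (e / 2) (x j)).
    exists (ball q (e / 2), [set L | (j <= L)%N]).
      split => /=; first by apply: nbhsx_ballx; lra.
      exact: nbhs_infty_ge.
    move=> [q' L] /= [qq' jL] m _; exists j => //.
    move: qj qq'; rewrite ballEmdist/=; have := metric_triangle (x j) q q'.
    by rewrite [mdist (x j) q]metric_sym; lra.
  exists (ball q (e / 2), setT).
    split => /=; first by apply: nbhsx_ballx; lra.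
    exact: filterT.
  by move=> [q' L] /= [qq' _] m xm; case: nj; exists m; rewrite xm.
move=> /(_ _ step)/filter_ex[L LP].
by exists L => m; exact: LP (Kx m) m erefl.
Qed.

(** If [x j] is [e]-close to [x (k + L)] with [j <= L], the two tails remain
[e]-close, so that [k + L - j] is an [e]-almost-period. *)
Lemma compact_almost_period (K : set M) (e : R) :
  compact K -> (forall i, K (x i)) -> 0 < e ->
  exists L, forall k, exists2 tau, (k <= tau <= k + L)%N &
    forall i, (L <= i)%N -> mdist (x (tau + i)) (x i) <= e.
Proof.
move=> Kc Kx e0; have [L LP] := compact_net Kc Kx e0.
exists L => k; have [j jL xj] := LP (k + L)%N.
exists (k + L - j)%N; first by lia.
move=> i Li; apply: le_trans xj; rewrite metric_sym.
have -> : (k + L - j + i = k + L + (i - j))%N by lia.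
by rewrite -{1}(subnKC (leq_trans jL Li)).
Qed.

End nonexpansive_sequence.

(** * Uniform convergence of the Karcher means *)

Section karcher_means.
Context {R : realType} {H : hadamardType R}.
Variable x : nat -> H.
Hypothesis x_ne : forall i j k,
  mdist (x (i + k)) (x (j + k)) <= mdist (x i) (x j).
Variables (p : H) (D : R).
Hypothesis xD : forall i, mdist (x i) p <= D.
Hypothesis H_lc : locally_compact [set: H].

Lemma karcher_fun_uniform (e : R) : 0 < e -> exists2 N, (0 < N)%N &
  forall w, mdist w p <= D -> forall n m k l, (N <= n)%N -> (N <= m)%N ->
    `|karcher_fun x n k w - karcher_fun x m l w| <= e.
Proof.
move=> e0; have D0 : 0 <= D by apply: le_trans (xD 0%N); exact: mdist_ge0.
have D4 : 0 < 4 * D + 1 by lra.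
pose eta := e / 12; have eta0 : 0 < eta by rewrite /eta; lra.
have Kx i : cball p D (x i) by rewrite /cball/= metric_sym.
have [L LP] :=
  compact_almost_period x_ne (@cball_compact R H p D H_lc) Kx (divr_gt0 eta0 D4).
(* [karcher_fun x n k w] is, by definition, [window_avg] of the sequence of the
   squared distances to [w]; on the ball of radius [D] these are bounded by
   [(2 * D)^2] and [4 * D]-Lipschitz in [x i]. *)
have [N N0 NP] := almost_periodic_mean ((2 * D) ^+ 2) L eta0.
exists N => // w wD n m k l Nn Nm.
have bnd i : mdist (x i) w <= 2 * D.
  by have := metric_triangle (x i) p w; have := xD i;
    rewrite [mdist p w]metric_sym; lra.
have := NP (fun i => mdist (x i) w ^+ 2) _ _ n m k l Nn Nm.
have -> : 12 * eta = e by rewrite /eta; lra.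
apply.
  by move=> i; rewrite sqr_ge0 ler_sqr ?nnegrE ?mdist_ge0 ?bnd//=; lra.
move=> j; have [tau tauj tauP] := LP j; exists tau => // i Li.
rewrite subr_sqr normrM.
have -> : eta = (eta / (4 * D + 1)) * (4 * D + 1) by rewrite divfK// gt_eqF.
apply: ler_pM => //.
  rewrite [mdist _ w]metric_sym [mdist (x i) w]metric_sym.
  exact: le_trans (mdist_distl _ _ _) (tauP _ Li).
have := bnd i; have := bnd (tau + i)%N.
by rewrite ger0_norm ?addr_ge0 ?mdist_ge0//; lra.
Qed.

(** Add the growth inequalities of the two functions at their minimizers. *)
Lemma karcher_mean_uniform_cauchy (e : R) : 0 < e -> exists2 N, (0 < N)%N &
  forall n m k l, (N <= n)%N -> (N <= m)%N ->
    mdist (karcher_mean x n k) (karcher_mean x m l) <= e.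
Proof.
move=> e0; have [N N0 NP] := karcher_fun_uniform (exprn_gt0 2 e0).
exists N => // n m k l Nn Nm.
have n0 : (0 < n)%N by lia.
have m0 : (0 < m)%N by lia.
set s := karcher_mean x n k; set t := karcher_mean x m l.
have := karcher_meanP x n0 k t; have := karcher_meanP x m0 l s.
rewrite -/s -/t [mdist t s]metric_sym.
have := NP s (karcher_mean_bounded n0 k xD) n m k l Nn Nm.
have := NP t (karcher_mean_bounded m0 l xD) n m k l Nn Nm.
rewrite !ler_norml => /andP[? ?] /andP[? ?] ? ?.
by rewrite -ler_sqr ?nnegrE ?mdist_ge0 ?(ltW e0)//; lra.
Qed.

Lemma karcher_mean_uniform_limit : exists z, forall e : R, 0 < e ->
  exists2 N, (0 < N)%N &
    forall n k, (N <= n)%N -> mdist (karcher_mean x n k) z <= e.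
Proof.
pose s n := karcher_mean x n 0.
have /cauchy_cvg cs : cauchy (s @ \oo).
  apply/cauchyP => e e0.
  have [|N N0 NP] := @karcher_mean_uniform_cauchy (e / 2); first lra.
  exists (s N); exists N => // n /= Nn.
  rewrite /= ballEmdist/=; have := NP N n 0%N 0%N (leqnn _) Nn.
  by rewrite -/(s N) -/(s n); lra.
exists (lim (s @ \oo)) => e e0.
have [N N0 NP] := karcher_mean_uniform_cauchy e0.
exists N => // n k Nn.
apply: (@cball_limit R H (karcher_mean x n k) e (s @ \oo) _ _ _ cs).
by exists N => // m /= Nm; exact: NP.
Qed.

End karcher_means.

Lemma uniform_limit_almost_convergent (R : realType) (H : hadamardType R)
    (x : nat -> H) z :
  (forall e : R, 0 < e -> exists2 N, (0 < N)%N &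
    forall n k, (N <= n)%N -> mdist (karcher_mean x n k) z <= e) ->
  almost_convergent x z.
Proof.
move=> xz; rewrite /almost_convergent.
set u := fun n => _.
have u0 n : (0 <= u n)%E.
  apply: (@le_trans _ _ (mdist (karcher_mean x n 0) z)%:E).
    by rewrite lee_fin mdist_ge0.
  by apply: ereal_sup_ubound; exists 0%N.
have ue (e : R) : 0 < e -> \forall n \near \oo, (u n <= e%:E)%E.
  move=> /xz[N _ NP]; exists N => // n /= Nn.
  by apply: ge_ereal_sup => _ [k _ <-]; rewrite lee_fin NP.
have ufin (e : R) n : (u n <= e%:E)%E -> u n \is a fin_num.
  by move=> une; rewrite ge0_fin_numE//; apply: le_lt_trans une _; exact: ltry.
apply/fine_cvgP; split.
  by apply: filterS (ue 1 ltr01) => n /ufin.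
apply/cvgrPdist_le => e e0; apply: filterS (ue e e0) => n une.
rewrite sub0r normrN ger0_norm ?fine_ge0//.
by rewrite -lee_fin fineK// (ufin e).
Qed.

Theorem theorem4p4 (R : realType) (H : hadamardType R)
  (H_lc : locally_compact [set: H])
  (C : set H) (C_neq0 : C !=set0) (C_closed : closed C)
  (C_convex : geodesically_convex C)
  (T : H -> H) (T_C : set_fun C C T) (T_ne : nonexpansive_on C T)
  (FT_neq0 : fixed_points C T !=set0) :
  forall x, C x ->
    exists2 p, fixed_points C T p & almost_convergent (fun n => iter n T x) p.
Proof.
move=> x0 Cx0; pose x n := iter n T x0.
have Cx n : C (x n) by elim: n => //= n; exact: T_C.
have x_ne i j k : mdist (x (i + k)%N) (x (j + k)%N) <= mdist (x i) (x j).
  elim: k => [|k IHk]; first by rewrite !addn0.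
  by rewrite !addnS; apply: le_trans IHk; exact: T_ne.
have [p [Cp Tp]] := FT_neq0.
have xD n : mdist (x n) p <= mdist x0 p.
  elim: n => // n; apply: le_trans; rewrite -{1}Tp; exact: T_ne.
have [z zP] := karcher_mean_uniform_limit x_ne xD H_lc.
exists z; last exact: uniform_limit_almost_convergent.
have CK n k : (0 < n)%N -> C (karcher_mean x n k).
  by move=> n0; exact: karcher_mean_in.
have Cz : C z.
  apply: C_closed => A /nbhs_ballP[e /= e0 eA].
  have [|N N0 NP] := zP (e / 2); first lra.
  exists (karcher_mean x N 0); split; first exact: CK.
  by apply: eA; rewrite ballEmdist/= metric_sym; have := NP N 0%N (leqnn _); lra.
split => //; apply/mdist_positivity/eqP; rewrite eq_le mdist_ge0 andbT.
apply/ler_addgt0Pr => e e0; rewrite add0r.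
have e3 : 0 < e / 3 by lra.
have [N1 N10 N1P] := zP _ e3.
have [N2 N20 N2P] := karcher_fun_uniform x_ne xD H_lc (exprn_gt0 2 e3).
set n := maxn N1 N2.
have n0 : (0 < n)%N by rewrite /n; lia.
have N1n : (N1 <= n)%N by rewrite /n; lia.
have N2n : (N2 <= n)%N by rewrite /n; lia.
set s := karcher_mean x n 0; set s' := karcher_mean x n 1.
(* [T s] almost minimizes the function whose minimizer is [s']. *)
have Ts : mdist (T s) s' <= e / 3.
  have : karcher_fun x n 1 (T s) <= karcher_fun x n 0 s.
    rewrite ler_pM2l ?invr_gt0 ?ltr0n//; apply: ler_sum => i _.
    rewrite ler_sqr ?nnegrE ?mdist_ge0// add1n add0n.
    by apply: T_ne => //; exact: CK.
  have := karcher_meanP x n0 1 (T s); have := karcher_meanP x n0 0 s'.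
  have := N2P s' (karcher_mean_bounded n0 1 xD) n n 0%N 1%N N2n N2n.
  rewrite -/s -/s' ler_norml => /andP[_ ?] ? ? ?.
  rewrite -ler_sqr ?nnegrE ?mdist_ge0 ?(ltW e3)// [mdist (T s) s']metric_sym.
  by have := sqr_ge0 (mdist s s'); lra.
have Tzs : mdist (T z) (T s) <= e / 3.
  by apply: le_trans (T_ne _ _ Cz (CK _ _ n0)) _; rewrite metric_sym N1P.
have := metric_triangle (T z) (T s) z; have := metric_triangle (T s) s' z.
have := N1P n 1%N N1n; rewrite -/s'; lra.
Qed.
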